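(* Let $k\ge 4$, let $f_1(x),\dots,f_{k-1}(x)$ be smooth nowhere vanishing functions on an open interval $I\ni x_0$, let $g(x,t)$ be a given function, and suppose that there are functions $g_{i:k-1}(x,t)$ ($2\le i\le k-2$), $R_{f_{k-1}}(x,t)$, $G(x,t)$ with $$\partial_xG=g,\qquad f_{k-1}\,\partial_xR_{f_{k-1}}=G,\qquad f_{k-2}\,\partial_xg_{k-2:k-1}=R_{f_{k-1}},\qquad f_i\,\partial_xg_{i:k-1}=g_{i+1:k-1}\ (2\le i\le k-3).$$ Suppose that, for each fixed $t$, there exist elementary functions $\nu(x)$, $S(x)$ and a positive integer $p$ such that $$\nu^{(p+1)}(x)=\frac1{f_1(x)},\qquad S'(x)=\partial_x^{(p+1)}g_{2:k-1}(x,t)\;\nu(x).$$ Then $$\bar u_{k-1}(x,t)=\int_{x_0}^x\frac{g_{2:k-1}(s,t)}{f_1(s)}\,ds$$ is a particular solution, elementary with respect to $x$, of the equation $$\partial_x f_{k-1}\partial_x f_{k-2}\partial_x\cdots\partial_x f_2\partial_x f_1\partial_x u=g(x,t).$$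
   Context: Elementary functions: one considers differential fields whose elements are complex-valued functions of the real variable $x$ on a suitable open interval $I$ with derivation $d/dx$, starting from the field $\mathbb{C}(x)$ of rational functions (all fields can be taken inside the field of quotients of complex-valued real-analytic functions on $I$; the functions occurring in the statement are assumed defined and smooth in $x$ on $I$). A simple extension $K\subset K(g)$ is called elementary if it is exponential ($g'=s'g$ for some $s\in K$), or logarithmic ($g'=s'/s$ for some nonzero $s\in K$), or algebraic ($g$ is a root of an irreducible polynomial over $K$). A function is elementary if it belongs to the last field of a finite chain $\mathbb{C}(x)\subset K_1\subset\dots\subset K_r$ of elementary extensions. A function of $(x,t)$ is elementary with respect to $x$ if it is an elementary function of $x$ for each fixed $t$.
   Formalization: The formal theorem additionally assumes that $g_{2:k-1}(x,t)$ is elementary with respect to $x$; without this the claim fails (e.g. $\nu=e^{-x^2}$, $g_{2:3}=x\int e^{x^2}dx-e^{x^2}/2$), and it is necessary for the conclusion. *)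

(* Defs.v *)
From Stdlib Require Import Reals.
From Coquelicot Require Import Coquelicot.

Open Scope C_scope.

(** * Complex-valued functions of a real variable on an open interval

    The open interval is [{x | lo < x < hi}] with endpoints in [Rbar].
    Functions are total, [R -> C]; only their values on the interval matter. *)

Definition in_itv (lo hi : Rbar) (x : R) : Prop :=
  Rbar_lt lo x /\ Rbar_lt x hi.

(** [CDerive_n n f x] is the [n]-th derivative, taken on real and imaginary
    parts.  Like [Derive_n] it is total, so it is meaningful only together with
    a differentiability statement such as [smooth_on]. *)
Definition CDerive_n (n : nat) (f : R -> C) (x : R) : C :=
  (Derive_n (fun y => Re (f y)) n x, Derive_n (fun y => Im (f y)) n x).

Definition CDerive (f : R -> C) : R -> C := CDerive_n 1 f.

Definition smooth_on (lo hi : Rbar) (f : R -> C) : Prop :=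
  forall (n : nat) (x : R), in_itv lo hi x ->
    ex_derive_n (fun y => Re (f y)) n x /\ ex_derive_n (fun y => Im (f y)) n x.

Definition analytic_on (lo hi : Rbar) (f : R -> C) : Prop :=
  forall x0 : R, in_itv lo hi x0 ->
    exists (c : nat -> C) (r : posreal),
      forall x : R, (Rabs (x - x0) < r)%R ->
        @is_pseries R_AbsRing C_R_NormedModule c (x - x0)%R (f x).

(** * The field of quotients of analytic functions

    An element of this field is represented by any function [R -> C] that agrees
    with a quotient of analytic functions away from a closed discrete subset of
    the interval (a quotient has no value at its poles).  Equality in the field
    is [mero_eq]; the field operations and the derivation act pointwise. *)

Definition mero_eq (lo hi : Rbar) (f h : R -> C) : Prop :=
  forall y : R, in_itv lo hi y -> locally' y (fun x => f x = h x).

Definition meromorphic (lo hi : Rbar) (f : R -> C) : Prop :=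
  exists num den : R -> C,
    analytic_on lo hi num /\ analytic_on lo hi den /\
    (exists x : R, in_itv lo hi x /\ den x <> 0) /\
    mero_eq lo hi f (fun x => num x / den x).

(** Membership in a subfield must not depend on the chosen representative:
    this is [sf_compat]. *)
Record subfield (lo hi : Rbar) (K : (R -> C) -> Prop) : Prop := {
  sf_mero : forall f, K f -> meromorphic lo hi f;
  sf_compat : forall f h, K f -> mero_eq lo hi f h -> K h;
  sf_one : K (fun _ => 1);
  sf_add : forall f h, K f -> K h -> K (fun x => f x + h x);
  sf_opp : forall f, K f -> K (fun x => - f x);
  sf_mul : forall f h, K f -> K h -> K (fun x => f x * h x);
  sf_inv : forall f, K f -> ~ mero_eq lo hi f (fun _ => 0) ->
             K (fun x => / f x)
}.

Definition generated_field (lo hi : Rbar) (A : (R -> C) -> Prop) :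
    (R -> C) -> Prop :=
  fun f => forall L, subfield lo hi L -> (forall h, A h -> L h) -> L f.

(** [C(x)]: the field generated by the constants and the variable. *)
Definition rational_field (lo hi : Rbar) : (R -> C) -> Prop :=
  generated_field lo hi
    (fun f => (exists c : C, f = (fun _ => c)) \/ f = RtoC).

(** [K(g)] *)
Definition adjoin (lo hi : Rbar) (K : (R -> C) -> Prop) (g : R -> C) :
    (R -> C) -> Prop :=
  generated_field lo hi (fun f => K f \/ f = g).

(** * Polynomials over a subfield

    A polynomial is its sequence of coefficients, each coefficient being an
    element of the field of quotients. *)

Definition poly_degree (lo hi : Rbar) (K : (R -> C) -> Prop)
    (P : nat -> R -> C) (n : nat) : Prop :=
  (forall i, K (P i)) /\
  ~ mero_eq lo hi (P n) (fun _ => 0) /\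
  (forall i, (n < i)%nat -> mero_eq lo hi (P i) (fun _ => 0)).

Definition poly_mul (A B : nat -> R -> C) (m : nat) (x : R) : C :=
  sum_n (fun j => A j x * B (m - j)%nat x) m.

Definition irreducible_poly (lo hi : Rbar) (K : (R -> C) -> Prop)
    (P : nat -> R -> C) (n : nat) : Prop :=
  poly_degree lo hi K P n /\ (1 <= n)%nat /\
  ~ exists (A B : nat -> R -> C) (i j : nat),
      poly_degree lo hi K A i /\ (1 <= i)%nat /\
      poly_degree lo hi K B j /\ (1 <= j)%nat /\
      forall m, mero_eq lo hi (P m) (poly_mul A B m).

Definition poly_root (lo hi : Rbar) (P : nat -> R -> C) (n : nat)
    (g : R -> C) : Prop :=
  mero_eq lo hi (fun x => sum_n (fun i => P i x * Cpow (g x) i) n)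
    (fun _ => 0).

(** * Elementary functions *)

Definition exponential_over (lo hi : Rbar) (K : (R -> C) -> Prop)
    (g : R -> C) : Prop :=
  exists s, K s /\ mero_eq lo hi (CDerive g) (fun x => CDerive s x * g x).

Definition logarithmic_over (lo hi : Rbar) (K : (R -> C) -> Prop)
    (g : R -> C) : Prop :=
  exists s, K s /\ ~ mero_eq lo hi s (fun _ => 0) /\
    mero_eq lo hi (CDerive g) (fun x => CDerive s x / s x).

Definition algebraic_over (lo hi : Rbar) (K : (R -> C) -> Prop)
    (g : R -> C) : Prop :=
  exists (P : nat -> R -> C) (n : nat),
    irreducible_poly lo hi K P n /\ poly_root lo hi P n g.

(** The fields that end a finite chain of elementary extensions of [C(x)]. *)
Inductive elementary_field (lo hi : Rbar) : ((R -> C) -> Prop) -> Prop :=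
| elementary_field_base : elementary_field lo hi (rational_field lo hi)
| elementary_field_step (K : (R -> C) -> Prop) (g : R -> C) :
    elementary_field lo hi K ->
    meromorphic lo hi g ->
    exponential_over lo hi K g \/ logarithmic_over lo hi K g \/
      algebraic_over lo hi K g ->
    elementary_field lo hi (adjoin lo hi K g).

Definition elementary (lo hi : Rbar) (f : R -> C) : Prop :=
  exists K, elementary_field lo hi K /\ K f.

Definition elementary_wrt_x (lo hi : Rbar) (T : Type) (f : R -> T -> C) : Prop :=
  forall t : T, elementary lo hi (fun x => f x t).

(** * The differential equation *)

(** [factored_op f m u] is [d/dx f_m d/dx f_(m-1) ... d/dx f_1 d/dx u]. *)
Fixpoint factored_op (f : nat -> R -> C) (m : nat) (u : R -> C) : R -> C :=
  match m with
  | O => CDerive u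
  | S m' => CDerive (fun x => f m x * factored_op f m' u x)
  end.

(** The smoothness of [u] and of the [f i] makes all the derivatives taken in
    [factored_op] genuine. *)
Definition is_solution (lo hi : Rbar) (f : nat -> R -> C) (m : nat)
    (rhs u : R -> C) : Prop :=
  smooth_on lo hi u /\
  forall x, in_itv lo hi x -> factored_op f m u x = rhs x.

(* Main.v *)
Require Import Defs.
From Stdlib Require Import Reals Lra Lia Classical ClassicalEpsilon.
From Coquelicot Require Import Coquelicot.

Open Scope C_scope.

(** The hypotheses make [u' = g_2 / f_1 = g_2 * nu^(p+1)], where [g_2] is
    [gi 2].  Integrating by parts [p + 1] times moves all derivatives from [nu]
    to [g_2]: a primitive of [g_2 * nu^(p+1)] is a polynomial expression in the
    derivatives of [g_2] and [nu], plus or minus a primitive of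
    [g_2^(p+1) * nu], and [S] is one ([integration_by_parts]).  So [u] differs
    by a constant from an element of any differential field that contains
    [g_2], [nu] and [S].  That [u] solves the equation is the chain of
    hypotheses on [gi], [Rf] and [G] read from the inside out
    ([factored_op_step]).

    What remains is to find one elementary field that contains [g_2], [nu] and
    [S], and to see that elementary fields are closed under derivation.

    - Everything takes place among quotients of analytic functions, which form a
      field because an analytic function that is nonzero somewhere on the
      interval vanishes only at isolated points ([analytic_on_identity],
      [meromorphic_dichotomy], [subfield_meromorphic]).
    - A field generated by [A] is closed under derivation once the derivatives
      of the elements of [A] belong to it
      ([generated_field_derivation_closed]).  For an exponential or a logarithm
      this is the defining equation; for an algebraic [g] one differentiates a
      polynomial relation of least degree ([algebraic_CDerive]).
    - Two towers are joined by adding the generators of the second one on top of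
      the first ([elementary_field_compositum]).  An irreducible polynomial over
      the second tower may split over the larger field, so it is replaced by a
      polynomial of least degree, which is again irreducible
      ([minimal_poly_irreducible]). *)

(** * Properties that hold away from isolated points *)

Lemma locally_locally' (y : R) (P : R -> Prop) : locally y P -> locally' y P.
Proof. unfold locally', within; apply filter_imp; auto. Qed.

Lemma locally'_ex (y : R) (P : R -> Prop) : locally' y P -> exists x, P x.
Proof.
  intros [e He]; exists (y + e / 2)%R; pose proof (cond_pos e); apply He; [|lra].
  change (Rabs (y + e / 2 - y) < e)%R.
  replace (y + e / 2 - y)%R with (e / 2)%R by ring.
  rewrite Rabs_pos_eq; lra.
Qed.

Section Generic.

Context {lo hi : Rbar}.

Lemma locally_in_itv (x : R) : in_itv lo hi x -> locally x (in_itv lo hi).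
Proof.
  intros [Hlo Hhi].
  apply filter_and; [now apply open_Rbar_gt | now apply open_Rbar_lt].
Qed.

(** [P] holds on the interval off a set without accumulation points inside it;
    [mero_eq lo hi f h] unfolds to [generically lo hi (fun x => f x = h x)]. *)
Definition generically (P : R -> Prop) : Prop :=
  forall y : R, in_itv lo hi y -> locally' y P.

Lemma generically_and (P Q : R -> Prop) :
  generically P -> generically Q -> generically (fun x => P x /\ Q x).
Proof. intros HP HQ y Hy; apply filter_and; auto. Qed.

Lemma generically_imp (P Q : R -> Prop) :
  (forall x, P x -> Q x) -> generically P -> generically Q.
Proof. intros H HP y Hy; generalize (HP y Hy); now apply filter_imp. Qed.

Lemma generically_imp2 (P Q S : R -> Prop) :
  (forall x, P x -> Q x -> S x) -> generically P -> generically Q ->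
  generically S.
Proof.
  intros H HP HQ; generalize (generically_and _ _ HP HQ).
  apply generically_imp; intros x [HPx HQx]; auto.
Qed.

Lemma generically_on (P : R -> Prop) :
  (forall x, in_itv lo hi x -> P x) -> generically P.
Proof.
  intros H y Hy; apply locally_locally'.
  generalize (locally_in_itv y Hy); apply filter_imp; auto.
Qed.

Lemma generically_in_itv : generically (in_itv lo hi).
Proof. now apply generically_on. Qed.

Lemma generically_bounded (P : nat -> R -> Prop) (n : nat) :
  (forall i, (i <= n)%nat -> generically (P i)) ->
  generically (fun x => forall i, (i <= n)%nat -> P i x).
Proof.
  induction n as [|n IH]; intros H.
  - apply (generically_imp (P 0%nat)); [|now apply H].
    intros x Hx i Hi; now replace i with 0%nat by lia.
  - apply (generically_imp2 (fun x => forall i, (i <= n)%nat -> P i x) (P (S n))).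
    + intros x Hx HSn i Hi.
      destruct (Nat.eq_dec i (S n)) as [->|Hne]; [easy|apply Hx; lia].
    + apply IH; intros i Hi; apply H; lia.
    + now apply H.
Qed.

(** A punctured neighbourhood is open, so each of its points has a full
    neighbourhood inside it.  This is what allows generic equalities to be
    differentiated. *)
Lemma generically_locally (P : R -> Prop) :
  generically P -> generically (fun x => locally x P).
Proof.
  intros HP y Hy; generalize (locally_locally _ _ (HP y Hy)).
  unfold locally', within; apply filter_imp; intros x Hx Hxy.
  generalize (filter_and _ _ Hx (open_neq y x Hxy)).
  apply filter_imp; intros z [Hz Hzy]; auto.
Qed.

Lemma generically_exists (P : R -> Prop) (y : R) :
  in_itv lo hi y -> generically P -> exists x, in_itv lo hi x /\ P x.
Proof.
  intros Hy HP.
  exact (locally'_ex y _ (generically_and _ _ generically_in_itv HP y Hy)).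
Qed.

End Generic.
Arguments generically : clear implicits.
Arguments generically_in_itv : clear implicits.

(** * Real-analytic functions *)

Lemma least_nat (P : nat -> Prop) :
  (exists n, P n) -> exists n, P n /\ forall m, (m < n)%nat -> ~ P m.
Proof.
  intros [n Hn]; apply NNPP; intros Hno.
  revert Hn; apply (well_founded_ind PeanoNat.Nat.lt_wf_0 (fun n => ~ P n)).
  intros m IH Hm; apply Hno; now exists m.
Qed.

Section RealAnalytic.

Local Open Scope R_scope.

Definition real_analytic_at (f : R -> R) (y : R) : Prop :=
  exists (c : nat -> R) (r : posreal),
    forall x : R, (Rabs (x - y) < r) -> is_pseries c (x - y) (f x).

(** Beyond its radius of convergence a power series has terms that do not tend
    to zero. *)
Lemma CV_radius_ge (c : nat -> R) (r : R) :
  (forall x, (Rabs x < r) -> ex_pseries c x) -> Rbar_le r (CV_radius c).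
Proof.
  intros H; apply Rbar_not_lt_le; intros Hlt.
  pose proof (CV_radius_ge_0 c) as H0.
  destruct (CV_radius c) as [rho| |] eqn:E; simpl in Hlt, H0; try easy.
  assert (Habs : Rabs ((rho + r) / 2) = ((rho + r) / 2))
    by (apply Rabs_pos_eq; lra).
  apply (CV_disk_outside c ((rho + r) / 2)).
  - rewrite E, Habs; simpl; lra.
  - apply ex_series_lim_0.
    assert (Hex : ex_pseries c ((rho + r) / 2)) by (apply H; lra).
    revert Hex; apply ex_series_ext; intros n.
    rewrite pow_n_pow; apply Rmult_comm.
Qed.

(** The two descriptions are both of use: [is_pseries] has the lemma on products,
    [PSeries] those on continuity, differentiation and shifts. *)
Lemma real_analytic_at_PSeries (f : R -> R) (y : R) :
  real_analytic_at f y ->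
  exists (c : nat -> R) (r : posreal),
    Rbar_le r (CV_radius c) /\
    (forall x, (Rabs (x - y) < r) -> is_pseries c (x - y) (f x)) /\
    locally y (fun x => f x = PSeries c (x - y)).
Proof.
  intros [c [r H]]; exists c, r; split; [|split].
  - apply CV_radius_ge; intros x Hx; exists (f (x + y)).
    assert (Hs := H (x + y)).
    replace (x + y - y) with x in Hs by ring; now apply Hs.
  - exact H.
  - exists r; intros x Hx; symmetry; apply is_pseries_unique, H, Hx.
Qed.

(** If [c n] is the first nonzero coefficient, then [f x] is [(x - y)^n] times a
    continuous function that takes the value [c n] at [y]. *)
Lemma real_analytic_at_dichotomy (f : R -> R) (y : R) :
  real_analytic_at f y ->
  locally y (fun x => f x = 0) \/ locally' y (fun x => f x <> 0).
Proof.
  intros Hf; destruct (real_analytic_at_PSeries f y Hf) as [c [r [Hr [_ Hloc]]]].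
  destruct (classic (exists n, c n <> 0)) as [Hex|Hall].
  - right.
    destruct (least_nat _ Hex) as [n [Hn Hmin]].
    assert (Hlow : forall k, (k < n)%nat -> c k = 0)
      by (intros k Hk; apply NNPP, Hmin, Hk).
    assert (Hcont : continuity_pt (PSeries (PS_decr_n c n)) 0).
    { apply PSeries_continuity; rewrite Rabs_R0.
      apply Rbar_lt_le_trans with r; [apply cond_pos|].
      apply CV_radius_ge; intros x Hx; apply ex_pseries_decr_n.
      - destruct (Req_dec x 0) as [->|Hx0]; [now left|right].
        exists (/ x); now apply Rinv_l.
      - apply CV_radius_inside; now apply Rbar_lt_le_trans with r. }
    assert (Hne0 : PSeries (PS_decr_n c n) 0 <> 0).
    { rewrite PSeries_0; unfold PS_decr_n; now rewrite Nat.add_0_r. }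
    assert (Hnz : locally y (fun x => PSeries (PS_decr_n c n) (x - y) <> 0)).
    { assert (Hc2 : continuous (fun x => PSeries (PS_decr_n c n) (x - y)) y).
      { apply (continuous_comp (fun x : R => (x - y))).
        - apply (continuous_minus (V := R_NormedModule) (fun x : R => x)).
          + apply continuous_id.
          + apply continuous_const.
        - rewrite Rminus_diag; now apply continuity_pt_filterlim. }
      apply (Hc2 (fun z => z <> 0)); simpl.
      rewrite Rminus_diag; now apply open_neq. }
    unfold locally', within.
    generalize (filter_and _ _ Hloc Hnz); apply filter_imp.
    intros x [Hx Hxnz] Hxy.
    rewrite Hx, (PSeries_decr_n_aux c n) by exact Hlow.
    apply Rmult_integral_contrapositive_currified; [|exact Hxnz].
    apply pow_nonzero; lra.
  - left; revert Hloc; apply filter_imp; intros x ->.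
    rewrite (PSeries_ext c (fun _ => 0)); [apply PSeries_const_0|].
    intros n; apply NNPP; intros Hn; apply Hall; now exists n.
Qed.

Lemma real_analytic_at_ex_derive (f : R -> R) (y : R) :
  real_analytic_at f y -> ex_derive f y.
Proof.
  intros Hf; destruct (real_analytic_at_PSeries f y Hf) as [c [r [Hr [_ Hloc]]]].
  apply ex_derive_ext_loc with (fun x => PSeries c (x - y)).
  - revert Hloc; apply filter_imp; now intros x ->.
  - apply (ex_derive_comp (PSeries c) (fun x : R => (x - y))).
    + apply ex_derive_PSeries; rewrite Rminus_diag, Rabs_R0.
      apply Rbar_lt_le_trans with r; [apply cond_pos|exact Hr].
    + auto_derive; trivial.
Qed.

Lemma real_analytic_at_plus (f h : R -> R) (y : R) :
  real_analytic_at f y -> real_analytic_at h y ->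
  real_analytic_at (fun x => f x + h x) y.
Proof.
  intros [c [r H]] [d [s K]].
  exists (PS_plus c d), (mkposreal _ (Rmin_stable_in_posreal r s)).
  simpl; intros x Hx; apply (is_pseries_plus c d).
  - apply H; apply Rlt_le_trans with (1 := Hx), Rmin_l.
  - apply K; apply Rlt_le_trans with (1 := Hx), Rmin_r.
Qed.

Lemma real_analytic_at_opp (f : R -> R) (y : R) :
  real_analytic_at f y -> real_analytic_at (fun x => - f x) y.
Proof.
  intros [c [r H]]; exists (PS_opp c), r; intros x Hx.
  apply (is_pseries_opp c), H, Hx.
Qed.

Lemma real_analytic_at_mult (f h : R -> R) (y : R) :
  real_analytic_at f y -> real_analytic_at h y ->
  real_analytic_at (fun x => f x * h x) y.
Proof.
  intros Hf Hh.
  destruct (real_analytic_at_PSeries f y Hf) as [c [r [Hr [H _]]]].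
  destruct (real_analytic_at_PSeries h y Hh) as [d [s [Hs [K _]]]].
  exists (PS_mult c d), (mkposreal _ (Rmin_stable_in_posreal r s)).
  simpl; intros x Hx.
  assert (Hxr : (Rabs (x - y) < r)) by apply Rlt_le_trans with (1 := Hx), Rmin_l.
  assert (Hxs : (Rabs (x - y) < s)) by apply Rlt_le_trans with (1 := Hx), Rmin_r.
  apply is_pseries_mult; auto.
  - now apply Rbar_lt_le_trans with r.
  - now apply Rbar_lt_le_trans with s.
Qed.

Lemma is_pseries_const (a x : R) :
  is_pseries (fun n => match n with O => a | S _ => 0 end) x a.
Proof.
  assert (Hsum : forall n, sum_n (fun k => scal (pow_n x k)
    (match k with O => a | S _ => 0 end)) n = a).
  { induction n as [|n IH].
    - rewrite sum_O; apply Rmult_1_l.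
    - rewrite sum_Sn, IH; simpl.
      change (a + pow_n x (S n) * 0 = a); ring. }
  apply (filterlim_ext (fun _ => a)); [now intros n|].
  apply filterlim_const.
Qed.

Lemma real_analytic_at_const (a y : R) : real_analytic_at (fun _ => a) y.
Proof.
  eexists; exists (mkposreal _ Rlt_0_1); intros x _; apply is_pseries_const.
Qed.

Lemma real_analytic_at_id (y : R) : real_analytic_at (fun x => x) y.
Proof.
  eexists; exists (mkposreal _ Rlt_0_1); intros x _.
  replace x with ((x - y) * 1 + y) at 2 by ring.
  apply (is_pseries_plus (V := R_NormedModule)); [|apply is_pseries_const].
  apply (is_pseries_incr_1 (V := R_NormedModule)), is_pseries_const.
Qed.

End RealAnalytic.

(** * Complex-valued analytic functions *)

(** Complex-valued power series are pairs of real ones, so that the real theory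
    applies to real and imaginary parts separately. *)
Lemma is_pseries_components (c : nat -> C) (x : R) (l : C) :
  @is_pseries R_AbsRing C_R_NormedModule c x l <->
  is_pseries (fun n => Re (c n)) x (Re l) /\
  is_pseries (fun n => Im (c n)) x (Im l).
Proof.
  assert (Hsum : forall n,
    sum_n (fun k => @scal R_AbsRing C_R_NormedModule (pow_n x k) (c k)) n =
    (sum_n (fun k => scal (pow_n x k) (Re (c k))) n,
     sum_n (fun k => scal (pow_n x k) (Im (c k))) n)).
  { induction n as [|n IH].
    - now rewrite !sum_O.
    - now rewrite !sum_Sn, IH. }
  unfold is_pseries, is_series; split.
  - intros H; split; apply filterlim_locally; intros eps;
      generalize (proj1 (filterlim_locally _ _) H eps); apply filter_imp;
      intros n Hn; rewrite Hsum in Hn; apply Hn.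
  - intros [HRe HIm]; apply (proj2 (filterlim_locally _ _)); intros eps.
    generalize (filter_and _ _ (proj1 (filterlim_locally _ _) HRe eps)
                 (proj1 (filterlim_locally _ _) HIm eps)).
    apply filter_imp; intros n [H1 H2]; rewrite Hsum; now split.
Qed.

Lemma C_eq0 (z : C) : Re z = 0%R -> Im z = 0%R -> z = 0.
Proof. destruct z as [a b]; simpl; now intros -> ->. Qed.

Lemma analytic_on_components (lo hi : Rbar) (f : R -> C) :
  analytic_on lo hi f <->
  forall y, in_itv lo hi y ->
    real_analytic_at (fun x => Re (f x)) y /\
    real_analytic_at (fun x => Im (f x)) y.
Proof.
  split.
  - intros H y Hy; destruct (H y Hy) as [c [r Hc]]; split.
    + exists (fun n => Re (c n)), r; intros x Hx.
      apply (proj1 (is_pseries_components _ _ _) (Hc x Hx)).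
    + exists (fun n => Im (c n)), r; intros x Hx.
      apply (proj1 (is_pseries_components _ _ _) (Hc x Hx)).
  - intros H y Hy; destruct (H y Hy) as [[c [r Hc]] [d [s Hd]]].
    exists (fun n => (c n, d n)), (mkposreal _ (Rmin_stable_in_posreal r s)).
    simpl; intros x Hx; apply is_pseries_components; split.
    + apply Hc; apply Rlt_le_trans with (1 := Hx), Rmin_l.
    + apply Hd; apply Rlt_le_trans with (1 := Hx), Rmin_r.
Qed.

Lemma analytic_on_plus (lo hi : Rbar) (f h : R -> C) :
  analytic_on lo hi f -> analytic_on lo hi h ->
  analytic_on lo hi (fun x => f x + h x).
Proof.
  rewrite !analytic_on_components; intros Hf Hh y Hy.
  destruct (Hf y Hy), (Hh y Hy); split; now apply real_analytic_at_plus.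
Qed.

Lemma analytic_on_opp (lo hi : Rbar) (f : R -> C) :
  analytic_on lo hi f -> analytic_on lo hi (fun x => - f x).
Proof.
  rewrite !analytic_on_components; intros Hf y Hy.
  destruct (Hf y Hy); split; now apply real_analytic_at_opp.
Qed.

Lemma analytic_on_mult (lo hi : Rbar) (f h : R -> C) :
  analytic_on lo hi f -> analytic_on lo hi h ->
  analytic_on lo hi (fun x => f x * h x).
Proof.
  rewrite !analytic_on_components; intros Hf Hh y Hy.
  destruct (Hf y Hy), (Hh y Hy); split.
  - apply real_analytic_at_plus; [|apply real_analytic_at_opp];
      now apply real_analytic_at_mult.
  - apply real_analytic_at_plus; now apply real_analytic_at_mult.
Qed.

Lemma analytic_on_const (lo hi : Rbar) (c : C) : analytic_on lo hi (fun _ => c).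
Proof.
  apply analytic_on_components; intros y _; split; apply real_analytic_at_const.
Qed.

Lemma analytic_on_id (lo hi : Rbar) : analytic_on lo hi RtoC.
Proof.
  apply analytic_on_components; intros y _; split.
  - apply real_analytic_at_id.
  - apply (real_analytic_at_const 0%R).
Qed.

Lemma analytic_on_dichotomy (lo hi : Rbar) (f : R -> C) (y : R) :
  analytic_on lo hi f -> in_itv lo hi y ->
  locally y (fun x => f x = 0) \/ locally' y (fun x => f x <> 0).
Proof.
  intros Hf Hy; destruct (proj1 (analytic_on_components _ _ _) Hf y Hy) as [HRe HIm].
  destruct (real_analytic_at_dichotomy _ _ HRe) as [HRe0|HRe0].
  - destruct (real_analytic_at_dichotomy _ _ HIm) as [HIm0|HIm0].
    + left; generalize (filter_and _ _ HRe0 HIm0); apply filter_imp.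
      intros x [H1 H2]; now apply C_eq0.
    + right; revert HIm0; apply filter_imp; intros x Hx E; apply Hx; now rewrite E.
  - right; revert HRe0; apply filter_imp; intros x Hx E; apply Hx; now rewrite E.
Qed.

Lemma itv_between (lo hi : Rbar) (a b x : R) :
  in_itv lo hi a -> in_itv lo hi b -> (Rmin a b <= x <= Rmax a b)%R ->
  in_itv lo hi x.
Proof.
  intros [Ha1 Ha2] [Hb1 Hb2] [H1 H2]; split.
  - apply Rbar_lt_le_trans with (Rmin a b); [|exact H1].
    now apply (Rmin_case a b (fun m => Rbar_lt lo m)).
  - apply Rbar_le_lt_trans with (Rmax a b); [exact H2|].
    now apply (Rmax_case a b (fun m => Rbar_lt m hi)).
Qed.

Lemma constant_of_zero_derivative (lo hi : Rbar) (f : R -> R) :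
  (forall x, in_itv lo hi x -> is_derive f x 0%R) ->
  forall a b, in_itv lo hi a -> in_itv lo hi b -> f a = f b.
Proof.
  intros H a b Ha Hb.
  destruct (MVT_gen f a b (fun _ => 0%R)) as [c [_ Hc]].
  - intros x Hx; apply H, (itv_between lo hi a b x); auto; lra.
  - intros x Hx; apply continuity_pt_filterlim, (ex_derive_continuous f x).
    exists 0%R; apply H, (itv_between lo hi a b x); auto.
  - lra.
Qed.

(** The identity theorem.  The points near which [f] vanishes identically form an
    open set [Z], and by the dichotomy so do the other points; the indicator
    function [chi] of [Z] is thus locally constant, so it has derivative zero and
    is constant on the interval. *)
Lemma analytic_on_identity (lo hi : Rbar) (f : R -> C) (x0 : R) :
  analytic_on lo hi f -> in_itv lo hi x0 -> f x0 <> 0 ->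
  generically lo hi (fun x => f x <> 0).
Proof.
  intros Hf Hx0 Hne.
  pose (Z := fun y => locally y (fun x => f x = 0)).
  pose (chi := fun y => if excluded_middle_informative (Z y) then 1%R else 0%R).
  assert (Hchi : forall y, in_itv lo hi y -> is_derive chi y 0%R).
  { intros y Hy.
    apply (is_derive_ext_loc (fun _ => chi y));
      [|exact (@is_derive_const R_AbsRing R_NormedModule (chi y) y)].
    destruct (analytic_on_dichotomy lo hi f y Hf Hy) as [H|H].
    - generalize (locally_locally _ _ H); apply filter_imp; intros x Hx.
      unfold chi; destruct (excluded_middle_informative (Z x)),
        (excluded_middle_informative (Z y)); easy.
    - assert (HnZ : forall x, locally' x (fun z => f z <> 0) -> ~ Z x).
      { intros x Hx HZ.
        destruct (locally'_ex _ _ (filter_and _ _ Hx (locally_locally' _ _ HZ)));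
          tauto. }
      generalize (locally_locally _ _ H); apply filter_imp; intros x Hx.
      assert (HnZx : ~ Z x).
      { destruct (Req_dec x y) as [->|Hxy]; [now apply HnZ|].
        apply HnZ, locally_locally'.
        generalize (filter_and _ _ Hx (open_neq y x Hxy)).
        apply filter_imp; intros z [H1 H2]; auto. }
      unfold chi; destruct (excluded_middle_informative (Z x)),
        (excluded_middle_informative (Z y)); try easy.
      now destruct (HnZ y H). }
  intros y Hy; destruct (analytic_on_dichotomy lo hi f y Hf Hy) as [H|H]; [|exact H].
  exfalso; apply Hne.
  pose proof (constant_of_zero_derivative lo hi chi Hchi x0 y Hx0 Hy) as E.
  unfold chi in E.
  destruct (excluded_middle_informative (Z x0)) as [HZ|HZ],
    (excluded_middle_informative (Z y)); try easy.
  - now apply locally_singleton in HZ.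
  - lra.
Qed.

(** * Differentiation of complex-valued functions *)

(** Unlike [CDerive], which is total, this includes differentiability; [l] is left
    free so that derivatives can be computed by rules. *)
Definition is_Cderive (f : R -> C) (x : R) (l : C) : Prop :=
  is_derive (fun y => Re (f y)) x (Re l) /\
  is_derive (fun y => Im (f y)) x (Im l).

Lemma is_Cderive_unique (f : R -> C) (x : R) (l : C) :
  is_Cderive f x l -> CDerive f x = l.
Proof.
  intros [HRe HIm]; apply injective_projections.
  - exact (is_derive_unique _ _ _ HRe).
  - exact (is_derive_unique _ _ _ HIm).
Qed.

Lemma is_Cderive_correct (f : R -> C) (x : R) :
  ex_derive (fun y => Re (f y)) x -> ex_derive (fun y => Im (f y)) x ->
  is_Cderive f x (CDerive f x).
Proof. intros HRe HIm; split; now apply Derive_correct. Qed.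

Lemma is_Cderive_CDerive (f : R -> C) (x : R) (l : C) :
  is_Cderive f x l -> is_Cderive f x (CDerive f x).
Proof. intros H; now rewrite (is_Cderive_unique _ _ _ H). Qed.

Lemma is_Cderive_ext_loc (f h : R -> C) (x : R) (l : C) :
  locally x (fun y => f y = h y) -> is_Cderive f x l -> is_Cderive h x l.
Proof.
  intros E [HRe HIm]; split.
  - apply (is_derive_ext_loc (fun y => Re (f y))); [|exact HRe].
    revert E; apply filter_imp; now intros y ->.
  - apply (is_derive_ext_loc (fun y => Im (f y))); [|exact HIm].
    revert E; apply filter_imp; now intros y ->.
Qed.

Lemma CDerive_ext_loc (f h : R -> C) (x : R) :
  locally x (fun y => f y = h y) -> CDerive f x = CDerive h x.
Proof.
  intros E; unfold CDerive, CDerive_n; f_equal; apply Derive_n_ext_loc;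
    revert E; apply filter_imp; now intros y ->.
Qed.

Lemma is_Cderive_eq (f : R -> C) (x : R) (l m : C) :
  is_Cderive f x l -> l = m -> is_Cderive f x m.
Proof. now intros H <-. Qed.

Lemma is_Cderive_const (c : C) (x : R) : is_Cderive (fun _ => c) x 0.
Proof. split; exact (@is_derive_const R_AbsRing R_NormedModule _ x). Qed.

Lemma is_Cderive_id (x : R) : is_Cderive RtoC x 1.
Proof.
  split; [exact (@is_derive_id R_AbsRing x)|].
  exact (@is_derive_const R_AbsRing R_NormedModule _ x).
Qed.

Lemma is_Cderive_plus (f h : R -> C) (x : R) (l m : C) :
  is_Cderive f x l -> is_Cderive h x m ->
  is_Cderive (fun y => f y + h y) x (l + m).
Proof.
  intros [Hf1 Hf2] [Hh1 Hh2]; split;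
    now apply (@is_derive_plus R_AbsRing R_NormedModule).
Qed.

Lemma is_Cderive_opp (f : R -> C) (x : R) (l : C) :
  is_Cderive f x l -> is_Cderive (fun y => - f y) x (- l).
Proof.
  intros [Hf1 Hf2]; split; now apply (@is_derive_opp R_AbsRing R_NormedModule).
Qed.

Lemma is_Cderive_mult (f h : R -> C) (x : R) (l m : C) :
  is_Cderive f x l -> is_Cderive h x m ->
  is_Cderive (fun y => f y * h y) x (l * h x + f x * m).
Proof.
  intros [Hf1 Hf2] [Hh1 Hh2].
  assert (Hmul : forall (a b : R -> R) (da db : R),
    is_derive a x da -> is_derive b x db ->
    is_derive (fun y => a y * b y)%R x (da * b x + a x * db)%R).
  { intros a b da db Ha Hb; apply (is_derive_mult a b); auto; exact Rmult_comm. }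
  split; simpl.
  - evar_last.
    + apply (@is_derive_minus R_AbsRing R_NormedModule); apply Hmul; eassumption.
    + change (minus ?a ?b) with (a - b)%R; unfold Re, Im; ring.
  - evar_last.
    + apply (@is_derive_plus R_AbsRing R_NormedModule); apply Hmul; eassumption.
    + change (plus ?a ?b) with (a + b)%R; unfold Re, Im; ring.
Qed.

Lemma is_Cderive_inv (f : R -> C) (x : R) (l : C) :
  f x <> 0 -> is_Cderive f x l ->
  is_Cderive (fun y => / f y) x (- l / (f x * f x)).
Proof.
  intros Hne [Hf1 Hf2].
  assert (Hn : (Re (f x) ^ 2 + Im (f x) ^ 2 <> 0)%R).
  { intros E; apply Hne, C_eq0; nra. }
  split.
  - evar_last.
    + apply (is_derive_div (fun y => Re (f y))
               (fun y => Re (f y) ^ 2 + Im (f y) ^ 2)%R); [exact Hf1| |exact Hn].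
      apply (@is_derive_plus R_AbsRing R_NormedModule);
        apply is_derive_pow; eassumption.
    + cbv beta in *; destruct (f x) as [a b], l as [c d].
      unfold Cdiv, Cinv, Copp, Cmult, plus; simpl in *. field.
      split; nra.
  - evar_last.
    + apply (is_derive_div (fun y => - Im (f y))%R
               (fun y => Re (f y) ^ 2 + Im (f y) ^ 2)%R);
        [apply (@is_derive_opp R_AbsRing R_NormedModule); exact Hf2| |exact Hn].
      apply (@is_derive_plus R_AbsRing R_NormedModule);
        apply is_derive_pow; eassumption.
    + cbv beta in *; destruct (f x) as [a b], l as [c d].
      unfold Cdiv, Cinv, Copp, Cmult, plus, opp; simpl in *. field.
      split; nra.
Qed.

Lemma analytic_on_is_Cderive (lo hi : Rbar) (f : R -> C) (x : R) :
  analytic_on lo hi f -> in_itv lo hi x -> is_Cderive f x (CDerive f x).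
Proof.
  intros Hf Hx; destruct (proj1 (analytic_on_components _ _ _) Hf x Hx).
  now apply is_Cderive_correct; apply real_analytic_at_ex_derive.
Qed.

(** * Polynomials with complex coefficients *)

(** A sum over [C] has its type stated through the additive structure of [C], and
    [ring] finds the ring [C] only from an equality stated in [C] itself. *)
Ltac cring := match goal with |- ?a = ?b => change (@eq C a b) end; ring.

Lemma Csum_Sn (u : nat -> C) (n : nat) : sum_n u (S n) = sum_n u n + u (S n).
Proof. exact (sum_Sn u n). Qed.

Lemma Csum_Sl (u : nat -> C) (n : nat) :
  sum_n u (S n) = u 0%nat + sum_n (fun i => u (S i)) n.
Proof.
  induction n as [|n IH].
  - now rewrite Csum_Sn, !sum_O.
  - rewrite Csum_Sn, IH, Csum_Sn; cring.
Qed.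

Lemma Csum_scal (c : C) (u : nat -> C) (n : nat) :
  sum_n (fun i => c * u i) n = c * sum_n u n.
Proof.
  induction n as [|n IH].
  - now rewrite !sum_O.
  - rewrite !Csum_Sn, IH; cring.
Qed.

Lemma Csum_plus (u v : nat -> C) (n : nat) :
  sum_n (fun i => u i + v i) n = sum_n u n + sum_n v n.
Proof. exact (sum_n_plus u v n). Qed.

Lemma Csum_zero (u : nat -> C) (n : nat) :
  (forall i, (i <= n)%nat -> u i = 0) -> sum_n u n = RtoC 0.
Proof.
  induction n as [|n IH]; intros H.
  - rewrite sum_O; now apply H.
  - rewrite Csum_Sn, IH, (H (S n)) by auto; cring.
Qed.

(** The coefficients of a product: [poly_mul A B m x] is
    [Cconv (fun i => A i x) (fun i => B i x) m]. *)
Definition Cconv (a b : nat -> C) (m : nat) : C :=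
  sum_n (fun l => a l * b (m - l)%nat) m.

Definition Ceval (a : nat -> C) (n : nat) (z : C) : C :=
  sum_n (fun i => a i * Cpow z i) n.

Lemma Cconv_Sl (a b : nat -> C) (m : nat) :
  Cconv a b (S m) = a 0%nat * b (S m) + Cconv (fun l => a (S l)) b m.
Proof. unfold Cconv; now rewrite Csum_Sl. Qed.

Lemma Ceval_Sl (a : nat -> C) (n : nat) (z : C) :
  Ceval a (S n) z = a 0%nat + z * Ceval (fun i => a (S i)) n z.
Proof.
  unfold Ceval; rewrite Csum_Sl, <- Csum_scal; f_equal; [simpl; cring|].
  apply sum_n_ext; intros i; simpl; cring.
Qed.

Lemma Ceval_pad (a : nat -> C) (n m : nat) (z : C) :
  (n <= m)%nat -> (forall i, (n < i <= m)%nat -> a i = 0) ->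
  Ceval a m z = Ceval a n z.
Proof.
  intros Hnm; induction Hnm as [|m Hnm IH]; intros H; [easy|].
  unfold Ceval in *; rewrite Csum_Sn, (H (S m)), IH; [cring| |lia].
  intros i Hi; apply H; lia.
Qed.

Lemma Cconv_const (a b : nat -> C) (m : nat) :
  (forall l, (0 < l <= m)%nat -> a l = 0) -> Cconv a b m = a 0%nat * b m.
Proof.
  destruct m as [|m]; intros Ha; [apply sum_O|].
  rewrite Cconv_Sl; unfold Cconv; rewrite Csum_zero; [cring|].
  intros l Hl; rewrite Ha by lia; cring.
Qed.

(** Degree conditions are only required of finitely many coefficients, here and
    below: a property can be made to hold for finitely many coefficient functions
    at once off isolated points, not for all of them. *)
Lemma Cconv_top (a b : nat -> C) (i j : nat) :
  (forall l, (i < l <= i + j)%nat -> a l = 0) ->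
  (forall l, (j < l <= i + j)%nat -> b l = 0) ->
  Cconv a b (i + j) = a i * b j.
Proof.
  revert a; induction i as [|i IH]; intros a Ha Hb; simpl.
  - now apply Cconv_const.
  - rewrite Cconv_Sl, IH.
    + rewrite Hb by lia; cring.
    + intros l Hl; apply Ha; lia.
    + intros l Hl; apply Hb; lia.
Qed.

Lemma Cconv_above (a b : nat -> C) (i j m : nat) :
  (i + j < m)%nat ->
  (forall l, (i < l <= m)%nat -> a l = 0) ->
  (forall l, (j < l <= m)%nat -> b l = 0) ->
  Cconv a b m = 0.
Proof.
  revert a m; induction i as [|i IH]; intros a m Hm Ha Hb.
  - rewrite Cconv_const, (Hb m) by (auto; lia); cring.
  - destruct m as [|m]; [lia|].
    rewrite Cconv_Sl, IH, (Hb (S m)); try lia; [cring| |].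
    + intros l Hl; apply Ha; lia.
    + intros l Hl; apply Hb; lia.
Qed.

(** Evaluation is multiplicative.  Splitting off the constant coefficient of [a]
    reduces the degree of [a] by one. *)
Lemma Ceval_conv (a b : nat -> C) (i j : nat) (z : C) :
  (forall l, (i < l <= i + j)%nat -> a l = 0) ->
  (forall l, (j < l <= i + j)%nat -> b l = 0) ->
  Ceval (Cconv a b) (i + j) z = Ceval a i z * Ceval b j z.
Proof.
  revert a; induction i as [|i IH]; intros a Ha Hb; simpl.
  - unfold Ceval at 2; rewrite sum_O; unfold Ceval.
    rewrite <- Csum_scal; apply sum_n_ext_loc; intros l Hl.
    rewrite Cconv_const; [simpl; cring|]. intros q Hq; apply Ha; lia.
  - rewrite (Ceval_Sl a), Ceval_Sl.
    rewrite <- (Ceval_pad b j (S i + j) z) by (auto; lia); simpl.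
    rewrite (Ceval_Sl b).
    assert (E : Ceval (fun m => Cconv a b (S m)) (i + j) z =
      a 0%nat * Ceval (fun m => b (S m)) (i + j) z +
      Ceval (Cconv (fun l => a (S l)) b) (i + j) z).
    { unfold Ceval; rewrite <- Csum_scal, <- Csum_plus.
      apply sum_n_ext; intros m; rewrite Cconv_Sl; cring. }
    rewrite E, IH.
    + rewrite <- (Ceval_pad b j (S i + j) z) by (auto; lia); simpl.
      rewrite (Ceval_Sl b).
      unfold Cconv at 1; rewrite sum_O; simpl; cring.
    + intros l Hl; apply Ha; lia.
    + intros l Hl; apply Hb; lia.
Qed.

Lemma is_Cderive_pow (g : R -> C) (x : R) (l : C) (n : nat) :
  is_Cderive g x l ->
  is_Cderive (fun y => Cpow (g y) (S n)) x (RtoC (INR (S n)) * Cpow (g x) n * l).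
Proof.
  intros Hg; induction n as [|n IH].
  - apply is_Cderive_eq with (l * 1 + g x * 0); [|simpl; cring].
    apply (is_Cderive_mult g (fun _ => RtoC 1)); [exact Hg|apply is_Cderive_const].
  - eapply is_Cderive_eq.
    + apply (is_Cderive_mult g (fun y => Cpow (g y) (S n))); eassumption.
    + rewrite (S_INR (S n)), RtoC_plus; cbn [Cpow]; cring.
Qed.

(** The chain rule for a polynomial relation: differentiate the coefficients, then
    the argument.  The degree is written as a successor so that the formal
    derivative is again a polynomial, of degree [n]. *)
Lemma is_Cderive_eval (P : nat -> R -> C) (g : R -> C) (x : R) (n : nat) :
  (forall i, (i <= S n)%nat -> is_Cderive (P i) x (CDerive (P i) x)) ->
  is_Cderive g x (CDerive g x) ->
  is_Cderive (fun y => Ceval (fun i => P i y) (S n) (g y)) x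
    (Ceval (fun i => CDerive (P i) x) (S n) (g x) +
     Ceval (fun i => RtoC (INR (S i)) * P (S i) x) n (g x) * CDerive g x).
Proof.
  intros HP Hg.
  assert (Hmon : forall k, (S k <= S n)%nat ->
    is_Cderive (fun y => P (S k) y * Cpow (g y) (S k)) x
      (CDerive (P (S k)) x * Cpow (g x) (S k) +
       P (S k) x * (RtoC (INR (S k)) * Cpow (g x) k * CDerive g x))).
  { intros k Hk; apply (is_Cderive_mult (P (S k))); [now apply HP|].
    now apply is_Cderive_pow. }
  induction n as [|n IH].
  - apply (is_Cderive_ext_loc (fun y => P 0%nat y + P 1%nat y * Cpow (g y) 1)).
    + apply filter_forall; intros y; unfold Ceval.
      rewrite Csum_Sn, sum_O; simpl; cring.
    + eapply is_Cderive_eq.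
      * apply is_Cderive_plus; [now apply HP; lia|now apply Hmon].
      * unfold Ceval; rewrite Csum_Sn, !sum_O; simpl; cring.
  - apply (is_Cderive_ext_loc (fun y => Ceval (fun i => P i y) (S n) (g y) +
             P (S (S n)) y * Cpow (g y) (S (S n)))).
    + apply filter_forall; intros y; unfold Ceval; now rewrite (Csum_Sn _ (S n)).
    + eapply is_Cderive_eq.
      * apply is_Cderive_plus; [apply IH|now apply Hmon].
        -- intros i Hi; apply HP; lia.
        -- intros k Hk; apply Hmon; lia.
      * unfold Ceval; rewrite (Csum_Sn _ (S n)), !(Csum_Sn _ n); cring.
Qed.

(** * The field of meromorphic functions and its subfields *)

Section Fields.

Context (lo hi : Rbar) (x0 : R) (hx0 : in_itv lo hi x0).

(** By the identity theorem a denominator that is nonzero at one point is nonzero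
    off isolated points. *)
Lemma meromorphic_quotient (f : R -> C) :
  meromorphic lo hi f <->
  exists num den, analytic_on lo hi num /\ analytic_on lo hi den /\
    generically lo hi (fun x => den x <> 0 /\ f x = num x / den x).
Proof.
  split.
  - intros (num & den & Hnum & Hden & (x & Hx & Hne) & Hf); exists num, den.
    repeat split; auto.
    apply generically_and; [|exact Hf].
    now apply analytic_on_identity with x.
  - intros (num & den & Hnum & Hden & Hf); exists num, den.
    repeat split; auto.
    + destruct (generically_exists _ x0 hx0 Hf) as [x [Hx [Hne _]]]; eauto.
    + revert Hf; apply generically_imp; now intros x [].
Qed.

Lemma meromorphic_analytic (f : R -> C) :
  analytic_on lo hi f -> meromorphic lo hi f.
Proof.
  intros Hf; apply meromorphic_quotient; exists f, (fun _ => 1).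
  repeat split; auto.
  - apply analytic_on_const.
  - apply generically_on; intros x _; split; [apply C1_nz|field; apply C1_nz].
Qed.

(** This makes inverses available in the field of quotients and excludes zero
    divisors. *)
Lemma meromorphic_dichotomy (f : R -> C) :
  meromorphic lo hi f ->
  mero_eq lo hi f (fun _ => 0) \/ generically lo hi (fun x => f x <> 0).
Proof.
  intros Hf; apply meromorphic_quotient in Hf.
  destruct Hf as (num & den & Hnum & Hden & Hf).
  destruct (classic (exists x, in_itv lo hi x /\ num x <> 0)) as [[y [Hy Hne]]|H0].
  - right; generalize (analytic_on_identity _ _ _ _ Hnum Hy Hne), Hf.
    apply generically_imp2; intros x Hx [Hd ->].
    intros E; apply Hx.
    replace (num x) with (num x / den x * den x) by now field.
    rewrite E; ring.
  - left; generalize (generically_in_itv lo hi), Hf.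
    apply generically_imp2; intros x Hx [Hd ->].
    replace (num x) with (RtoC 0); [now field|].
    symmetry; apply NNPP; intros Hne; apply H0; now exists x.
Qed.

Lemma mero_eq_mult_0 (f h : R -> C) :
  meromorphic lo hi f -> mero_eq lo hi (fun x => f x * h x) (fun _ => 0) ->
  mero_eq lo hi f (fun _ => 0) \/ mero_eq lo hi h (fun _ => 0).
Proof.
  intros Hf H; destruct (meromorphic_dichotomy f Hf) as [H0|Hne]; [now left|right].
  revert Hne H; apply generically_imp2; intros x Hx E.
  apply NNPP; intros Hh; now apply (Cmult_neq_0 _ _ Hx Hh).
Qed.

Lemma subfield_meromorphic : subfield lo hi (meromorphic lo hi).
Proof.
  constructor.
  - easy.
  - intros f h Hf E; apply meromorphic_quotient in Hf.
    destruct Hf as (num & den & Hnum & Hden & Hf).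
    apply meromorphic_quotient; exists num, den; repeat split; auto.
    revert E Hf; apply generically_imp2; now intros x <-.
  - apply meromorphic_analytic, analytic_on_const.
  - intros f h Hf Hh; apply meromorphic_quotient in Hf, Hh.
    destruct Hf as (n1 & d1 & Hn1 & Hd1 & Hf), Hh as (n2 & d2 & Hn2 & Hd2 & Hh).
    apply meromorphic_quotient.
    exists (fun x => n1 x * d2 x + n2 x * d1 x), (fun x => d1 x * d2 x).
    split; [|split].
    + apply analytic_on_plus; now apply analytic_on_mult.
    + now apply analytic_on_mult.
    + revert Hf Hh; apply generically_imp2; intros x [H1 ->] [H2 ->].
      split; [now apply Cmult_neq_0|now field].
  - intros f Hf; apply meromorphic_quotient in Hf.
    destruct Hf as (n1 & d1 & Hn1 & Hd1 & Hf).
    apply meromorphic_quotient; exists (fun x => - n1 x), d1.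
    repeat split; auto; [now apply analytic_on_opp|].
    revert Hf; apply generically_imp; intros x [H1 ->]; split; [easy|now field].
  - intros f h Hf Hh; apply meromorphic_quotient in Hf, Hh.
    destruct Hf as (n1 & d1 & Hn1 & Hd1 & Hf), Hh as (n2 & d2 & Hn2 & Hd2 & Hh).
    apply meromorphic_quotient.
    exists (fun x => n1 x * n2 x), (fun x => d1 x * d2 x).
    split; [|split]; try now apply analytic_on_mult.
    revert Hf Hh; apply generically_imp2; intros x [H1 ->] [H2 ->].
    split; [now apply Cmult_neq_0|now field].
  - intros f Hf H0; destruct (meromorphic_dichotomy f Hf) as [E|Hne]; [easy|].
    apply meromorphic_quotient in Hf.
    destruct Hf as (n1 & d1 & Hn1 & Hd1 & Hf).
    apply meromorphic_quotient; exists d1, n1; repeat split; auto.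
    revert Hne Hf; apply generically_imp2; intros x Hx [H1 E].
    assert (Hn : n1 x <> 0).
    { intros En; apply Hx; rewrite E, En; now field. }
    split; [exact Hn|rewrite E; now field].
Qed.

Lemma meromorphic_is_Cderive (f : R -> C) :
  meromorphic lo hi f ->
  generically lo hi (fun x => is_Cderive f x (CDerive f x)).
Proof.
  intros Hf; apply meromorphic_quotient in Hf.
  destruct Hf as (num & den & Hnum & Hden & Hf).
  generalize (generically_and _ _ (generically_in_itv lo hi)
                (generically_locally _ Hf)).
  apply generically_imp; intros x [Hx Hloc].
  apply is_Cderive_CDerive with
    (CDerive num x * / den x + num x * (- CDerive den x / (den x * den x))).
  apply (is_Cderive_ext_loc (fun y => num y * / den y)).
  - revert Hloc; apply filter_imp; now intros y [_ ->].
  - apply is_Cderive_mult; [now apply analytic_on_is_Cderive with lo hi|].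
    apply is_Cderive_inv; [|now apply analytic_on_is_Cderive with lo hi].
    apply (locally_singleton _ _ Hloc).
Qed.

Lemma mero_eq_CDerive (f h : R -> C) :
  mero_eq lo hi f h -> mero_eq lo hi (CDerive f) (CDerive h).
Proof.
  intros E; generalize (generically_locally _ E).
  apply generically_imp; intros x; apply CDerive_ext_loc.
Qed.

Section Subfield.

Context (K : (R -> C) -> Prop) (HK : subfield lo hi K).

Lemma sf_ext (f h : R -> C) : K f -> (forall x, f x = h x) -> K h.
Proof.
  intros Hf E; apply (sf_compat _ _ _ HK f); [exact Hf|].
  apply generically_on; auto.
Qed.

Lemma sf_zero : K (fun _ => 0).
Proof.
  apply sf_ext with (fun _ => 1 + Copp 1).
  - apply (sf_add _ _ _ HK (fun _ => RtoC 1)); [apply (sf_one _ _ _ HK)|].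
    apply (sf_opp _ _ _ HK (fun _ => RtoC 1)), (sf_one _ _ _ HK).
  - intros x; ring.
Qed.

Lemma sf_sum (F : nat -> R -> C) (n : nat) :
  (forall i, K (F i)) -> K (fun x => sum_n (fun i => F i x) n).
Proof.
  intros HF; induction n as [|n IH].
  - apply sf_ext with (F 0%nat); [easy|]; intros x; now rewrite sum_O.
  - apply sf_ext with (fun x => sum_n (fun i => F i x) n + F (S n) x).
    + now apply (sf_add _ _ _ HK).
    + intros x; now rewrite sum_Sn.
Qed.

Lemma sf_pow (g : R -> C) (n : nat) : K g -> K (fun x => Cpow (g x) n).
Proof.
  intros Hg; induction n as [|n IH].
  - apply (sf_one _ _ _ HK).
  - now apply (sf_mul _ _ _ HK).
Qed.

Lemma sf_eval (P : nat -> R -> C) (n : nat) (g : R -> C) :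
  (forall i, K (P i)) -> K g -> K (fun x => sum_n (fun i => P i x * Cpow (g x) i) n).
Proof.
  intros HP Hg; apply (sf_sum (fun i x => P i x * Cpow (g x) i)); intros i.
  apply (sf_mul _ _ _ HK); [easy|now apply sf_pow].
Qed.

Lemma sf_is_Cderive (f : R -> C) :
  K f -> generically lo hi (fun x => is_Cderive f x (CDerive f x)).
Proof. intros Hf; apply meromorphic_is_Cderive, (sf_mero _ _ _ HK), Hf. Qed.

End Subfield.

Lemma generated_field_incl (A : (R -> C) -> Prop) (f : R -> C) :
  A f -> generated_field lo hi A f.
Proof. intros Hf L HL HA; auto. Qed.

Lemma generated_field_subfield (A : (R -> C) -> Prop) :
  (forall f, A f -> meromorphic lo hi f) ->
  subfield lo hi (generated_field lo hi A).
Proof.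
  intros HA; constructor.
  - intros f Hf; apply Hf; [apply subfield_meromorphic|exact HA].
  - intros f h Hf E L HL HAL; apply (sf_compat _ _ _ HL f); [now apply Hf|exact E].
  - intros L HL HAL; apply (sf_one _ _ _ HL).
  - intros f h Hf Hh L HL HAL; apply (sf_add _ _ _ HL); [now apply Hf|now apply Hh].
  - intros f Hf L HL HAL; apply (sf_opp _ _ _ HL); now apply Hf.
  - intros f h Hf Hh L HL HAL; apply (sf_mul _ _ _ HL); [now apply Hf|now apply Hh].
  - intros f Hf Hne L HL HAL; apply (sf_inv _ _ _ HL); [now apply Hf|exact Hne].
Qed.

Definition derivation_closed (K : (R -> C) -> Prop) : Prop :=
  forall f, K f -> K (CDerive f).

(** By the rules for derivatives, the elements whose derivative stays in the
    generated field form a subfield; it contains the generators. *)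
Lemma generated_field_derivation_closed (A : (R -> C) -> Prop) :
  (forall f, A f -> meromorphic lo hi f) ->
  (forall f, A f -> generated_field lo hi A (CDerive f)) ->
  derivation_closed (generated_field lo hi A).
Proof.
  intros HA HDA.
  pose proof (generated_field_subfield A HA) as HK.
  set (K := generated_field lo hi A) in *.
  assert (HL : subfield lo hi (fun f => K f /\ K (CDerive f))).
  { constructor.
    - intros f [Hf _]; now apply (sf_mero _ _ _ HK).
    - intros f h [Hf Hdf] E; split.
      + now apply (sf_compat _ _ _ HK f).
      + apply (sf_compat _ _ _ HK (CDerive f)); [easy|now apply mero_eq_CDerive].
    - split; [apply (sf_one _ _ _ HK)|].
      apply sf_ext with (fun _ : R => RtoC 0); [easy|now apply sf_zero|].
      intros x; symmetry; apply is_Cderive_unique, is_Cderive_const.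
    - intros f h [Hf Hdf] [Hh Hdh]; split; [now apply (sf_add _ _ _ HK)|].
      apply (sf_compat _ _ _ HK (fun x => CDerive f x + CDerive h x));
        [now apply (sf_add _ _ _ HK)|].
      generalize (sf_is_Cderive K HK f Hf), (sf_is_Cderive K HK h Hh).
      apply generically_imp2; intros x H1 H2.
      symmetry; apply is_Cderive_unique; now apply is_Cderive_plus.
    - intros f [Hf Hdf]; split; [now apply (sf_opp _ _ _ HK)|].
      apply (sf_compat _ _ _ HK (fun x => - CDerive f x));
        [now apply (sf_opp _ _ _ HK)|].
      generalize (sf_is_Cderive K HK f Hf).
      apply generically_imp; intros x H1.
      symmetry; apply is_Cderive_unique; now apply is_Cderive_opp.
    - intros f h [Hf Hdf] [Hh Hdh]; split; [now apply (sf_mul _ _ _ HK)|].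
      apply (sf_compat _ _ _ HK (fun x => CDerive f x * h x + f x * CDerive h x)).
      { apply (sf_add _ _ _ HK); now apply (sf_mul _ _ _ HK). }
      generalize (sf_is_Cderive K HK f Hf), (sf_is_Cderive K HK h Hh).
      apply generically_imp2; intros x H1 H2.
      symmetry; apply is_Cderive_unique; now apply is_Cderive_mult.
    - intros f [Hf Hdf] Hne; split; [now apply (sf_inv _ _ _ HK)|].
      destruct (meromorphic_dichotomy f (sf_mero _ _ _ HK f Hf)) as [|Hgen]; [easy|].
      apply (sf_compat _ _ _ HK (fun x => - CDerive f x * (/ f x * / f x))).
      { apply (sf_mul _ _ _ HK); [now apply (sf_opp _ _ _ HK)|].
        apply (sf_mul _ _ _ HK); now apply (sf_inv _ _ _ HK). }
      generalize (sf_is_Cderive K HK f Hf), Hgen.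
      apply generically_imp2; intros x H1 H2.
      symmetry; apply is_Cderive_unique.
      apply is_Cderive_eq with (- CDerive f x / (f x * f x)).
      + now apply is_Cderive_inv.
      + now field. }
  intros f Hf; apply (Hf _ HL).
  intros h Hh; split; [now apply generated_field_incl|now apply HDA].
Qed.

Lemma rational_field_gen_meromorphic (f : R -> C) :
  (exists c : C, f = (fun _ => c)) \/ f = RtoC -> meromorphic lo hi f.
Proof.
  intros [[c ->] | ->]; apply meromorphic_analytic.
  - apply analytic_on_const.
  - apply analytic_on_id.
Qed.

Lemma rational_field_subfield : subfield lo hi (rational_field lo hi).
Proof. apply generated_field_subfield, rational_field_gen_meromorphic. Qed.

Lemma rational_field_derivation_closed :
  derivation_closed (rational_field lo hi).
Proof.
  apply generated_field_derivation_closed.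
  - apply rational_field_gen_meromorphic.
  - intros f Hf.
    assert (Hc : exists c : C, forall x, c = CDerive f x).
    { destruct Hf as [[c ->] | ->].
      - exists 0; intros x; symmetry; apply is_Cderive_unique, is_Cderive_const.
      - exists 1; intros x; symmetry; apply is_Cderive_unique, is_Cderive_id. }
    destruct Hc as [c Hc].
    apply (sf_ext _ rational_field_subfield (fun _ => c)); [|exact Hc].
    apply generated_field_incl; eauto.
Qed.

Lemma adjoin_subfield (K : (R -> C) -> Prop) (g : R -> C) :
  subfield lo hi K -> meromorphic lo hi g -> subfield lo hi (adjoin lo hi K g).
Proof.
  intros HK Hg; apply generated_field_subfield; intros f [Hf| ->]; [|exact Hg].
  now apply (sf_mero _ _ _ HK).
Qed.

Lemma elementary_field_subfield (K : (R -> C) -> Prop) :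
  elementary_field lo hi K -> subfield lo hi K.
Proof.
  induction 1 as [|K g HK IH Hg _].
  - apply rational_field_subfield.
  - now apply adjoin_subfield.
Qed.

Lemma elementary_field_const (K : (R -> C) -> Prop) (c : C) :
  elementary_field lo hi K -> K (fun _ => c).
Proof.
  induction 1 as [|K g HK IH _ _]; apply generated_field_incl; eauto.
Qed.

(** * Algebraic elements and towers of elementary extensions *)

(** [g] is a root of some polynomial of degree [n] over [K]; irreducibility is not
    demanded, so that the property passes to larger fields. *)
Definition annihilated (K : (R -> C) -> Prop) (g : R -> C) (n : nat) : Prop :=
  exists P, poly_degree lo hi K P n /\ poly_root lo hi P n g.

Lemma sf_INR (K : (R -> C) -> Prop) (n : nat) :
  subfield lo hi K -> K (fun _ => RtoC (INR n)).
Proof.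
  intros HK; induction n as [|n IH].
  - exact (sf_zero K HK).
  - apply (sf_ext K HK (fun _ => RtoC (INR n) + 1)).
    + apply (sf_add _ _ _ HK _ _ IH (sf_one _ _ _ HK)).
    + intros _; now rewrite S_INR, RtoC_plus.
Qed.

Lemma not_annihilated_0 (K : (R -> C) -> Prop) (g : R -> C) : ~ annihilated K g 0.
Proof.
  intros (P & (_ & Hne & _) & Hroot); apply Hne.
  revert Hroot; apply generically_imp; intros x Hx.
  rewrite sum_O in Hx; rewrite <- Hx; simpl; cring.
Qed.

(** If the polynomial were a product, then [g] would be a root of one of the two
    factors, because there are no zero divisors, and both have smaller degree. *)
Lemma minimal_poly_irreducible (K : (R -> C) -> Prop) (g : R -> C)
    (P : nat -> R -> C) (n : nat) :
  subfield lo hi K -> meromorphic lo hi g ->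
  poly_degree lo hi K P n -> poly_root lo hi P n g ->
  (forall m, (m < n)%nat -> ~ annihilated K g m) ->
  irreducible_poly lo hi K P n.
Proof.
  intros HK Hg HP Hroot Hmin; split; [exact HP|split].
  - destruct n as [|n]; [|lia].
    destruct (not_annihilated_0 K g); now exists P.
  - intros (A & B & i & j & HA & Hi & HB & Hj & Hprod).
    destruct HP as (HKP & HneP & HzP), HA as (HKA & HneA & HzA),
      HB as (HKB & HneB & HzB).
    assert (HzA' : forall N, generically lo hi
      (fun x => forall l, (l <= N)%nat -> (i < l)%nat -> A l x = 0)).
    { intros N; apply generically_bounded; intros l _.
      destruct (Nat.lt_ge_cases i l) as [Hl|Hl].
      - generalize (HzA l Hl); now apply generically_imp.
      - apply generically_on; intros; lia. }
    assert (HzB' : forall N, generically lo hi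
      (fun x => forall l, (l <= N)%nat -> (j < l)%nat -> B l x = 0)).
    { intros N; apply generically_bounded; intros l _.
      destruct (Nat.lt_ge_cases j l) as [Hl|Hl].
      - generalize (HzB l Hl); now apply generically_imp.
      - apply generically_on; intros; lia. }
    assert (Hdeg : n = (i + j)%nat).
    { destruct (Nat.lt_trichotomy n (i + j)) as [Hlt|[|Hlt]]; [exfalso|easy|exfalso].
      - assert (H0 : mero_eq lo hi (fun x => A i x * B j x) (fun _ => 0)).
        { generalize (generically_and _ _ (HzP _ Hlt) (Hprod (i + j)%nat)),
            (generically_and _ _ (HzA' (i + j)%nat) (HzB' (i + j)%nat)).
          apply generically_imp2; intros x [E1 E2] [E3 E4].
          rewrite <- E1, E2; symmetry.
          apply (Cconv_top (fun l => A l x) (fun l => B l x)); intros l [];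
            [apply E3|apply E4]; lia. }
        destruct (mero_eq_mult_0 _ _ (sf_mero _ _ _ HK _ (HKA i)) H0); auto.
      - apply HneP.
        generalize (Hprod n), (generically_and _ _ (HzA' n) (HzB' n)).
        apply generically_imp2; intros x E2 [E3 E4]; rewrite E2.
        apply (Cconv_above (fun l => A l x) (fun l => B l x) i j n Hlt);
          intros l []; [apply E3|apply E4]; lia. }
    assert (H0 : mero_eq lo hi
      (fun x => Ceval (fun l => A l x) i (g x) * Ceval (fun l => B l x) j (g x))
      (fun _ => 0)).
    { generalize (generically_and _ _ Hroot
        (generically_bounded _ n (fun m _ => Hprod m))),
        (generically_and _ _ (HzA' n) (HzB' n)).
      apply generically_imp2; intros x [E1 E2] [E3 E4].
      rewrite <- E1, Hdeg, <- Ceval_conv.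
      - apply sum_n_ext_loc; intros m Hm; f_equal.
        symmetry; apply E2; lia.
      - intros l []; apply E3; lia.
      - intros l []; apply E4; lia. }
    assert (HmA : meromorphic lo hi (fun x => Ceval (fun l => A l x) i (g x))).
    { apply (sf_mero _ _ _ subfield_meromorphic).
      apply (sf_eval _ subfield_meromorphic); [|exact Hg].
      intros l; now apply (sf_mero _ _ _ HK). }
    destruct (mero_eq_mult_0 _ _ HmA H0) as [HA|HB].
    + apply (Hmin i); [lia|]; exists A; repeat split; auto.
    + apply (Hmin j); [lia|]; exists B; repeat split; auto.
Qed.

Lemma minimal_annihilator (K : (R -> C) -> Prop) (g : R -> C) (m : nat) :
  annihilated K g m ->
  exists (P : nat -> R -> C) (n : nat),
    poly_degree lo hi K P n /\ poly_root lo hi P n g /\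
    forall k, (k < n)%nat -> ~ annihilated K g k.
Proof.
  intros Hm; destruct (least_nat _ (ex_intro _ m Hm)) as [n [[P [HP Hr]] Hmin]].
  now exists P, n.
Qed.

Lemma algebraic_over_annihilated (K K' : (R -> C) -> Prop) (g : R -> C) :
  (forall f, K f -> K' f) -> algebraic_over lo hi K g ->
  exists n, annihilated K' g n.
Proof.
  intros Hincl (P & n & [(HP & Hne & Hz) _] & Hroot).
  exists n, P; repeat split; auto.
Qed.

(** Differentiating the relation of least degree gives [A + B g' = 0], where [B] is
    the value at [g] of the formal derivative [Q].  The degree of [Q] is one less,
    with leading coefficient [n + 1] times the old one, so [B] is not zero by
    minimality and [g' = - A / B]. *)
Lemma algebraic_CDerive (K : (R -> C) -> Prop) (g : R -> C) :
  subfield lo hi K -> derivation_closed K -> meromorphic lo hi g ->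
  algebraic_over lo hi K g -> adjoin lo hi K g (CDerive g).
Proof.
  intros HK HD Hg Halg.
  destruct (algebraic_over_annihilated K K g (fun _ H => H) Halg) as [m Hm].
  destruct (minimal_annihilator K g m Hm) as (P & n & HP & Hroot & Hmin).
  destruct n as [|n]; [destruct (not_annihilated_0 K g); now exists P|].
  destruct HP as (HKP & HneP & HzP).
  pose proof (adjoin_subfield K g HK Hg) as HM.
  assert (Hincl : forall f, K f -> adjoin lo hi K g f)
    by (intros f Hf; apply generated_field_incl; now left).
  assert (HMg : adjoin lo hi K g g) by (apply generated_field_incl; now right).
  set (Q := fun (i : nat) (x : R) => RtoC (INR (S i)) * P (S i) x).
  assert (HKQ : forall i, K (Q i)).
  { intros i; apply (sf_mul _ _ _ HK (fun _ => RtoC (INR (S i)))); [|easy].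
    now apply sf_INR. }
  set (A := fun x => Ceval (fun i => CDerive (P i) x) (S n) (g x)).
  set (B := fun x => Ceval (fun i => Q i x) n (g x)).
  assert (HA : adjoin lo hi K g A).
  { apply (sf_eval _ HM (fun i => CDerive (P i))); auto. }
  assert (HB : adjoin lo hi K g B) by (apply (sf_eval _ HM Q); auto).
  assert (HB0 : ~ mero_eq lo hi B (fun _ => 0)).
  { intros H0; apply (Hmin n); [lia|]; exists Q; split; [|exact H0].
    split; [exact HKQ|split].
    - intros HQ; apply HneP; revert HQ; apply generically_imp; intros x Hx.
      apply NNPP; intros Hne; revert Hx; apply Cmult_neq_0; [|exact Hne].
      intros E; apply (not_0_INR (S n)); [lia|]; now apply RtoC_inj.
    - intros i Hi; assert (Hz := HzP (S i) ltac:(lia)); revert Hz.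
      apply generically_imp; intros x Hx; unfold Q; rewrite Hx; cring. }
  apply (sf_compat _ _ _ HM (fun x => - A x * / B x)).
  { apply (sf_mul _ _ _ HM); [now apply (sf_opp _ _ _ HM)|].
    now apply (sf_inv _ _ _ HM). }
  destruct (meromorphic_dichotomy B (sf_mero _ _ _ HM B HB)) as [|HBne]; [easy|].
  assert (HF : generically lo hi (fun x => A x + B x * CDerive g x = 0)).
  { generalize
      (generically_and _ _ (generically_locally _ Hroot) (meromorphic_is_Cderive g Hg)),
      (generically_bounded _ (S n)
        (fun i _ => sf_is_Cderive K HK (P i) (HKP i))).
    apply generically_imp2; intros x [Hloc Hdg] HdP.
    transitivity (CDerive (fun y => Ceval (fun i => P i y) (S n) (g y)) x).
    { symmetry; now apply is_Cderive_unique, is_Cderive_eval. }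
    transitivity (CDerive (fun _ => RtoC 0) x); [exact (CDerive_ext_loc _ _ x Hloc)|].
    apply is_Cderive_unique, is_Cderive_const. }
  revert HBne HF; apply generically_imp2; intros x HBx E.
  replace (- A x) with (B x * CDerive g x)
    by (rewrite <- (Cplus_0_r (- A x)), <- E; cring).
  now field.
Qed.

Lemma elementary_field_derivation_closed (K : (R -> C) -> Prop) :
  elementary_field lo hi K -> derivation_closed K.
Proof.
  induction 1 as [|K g HK IH Hg Hstep]; [apply rational_field_derivation_closed|].
  pose proof (elementary_field_subfield K HK) as HsK.
  pose proof (adjoin_subfield K g HsK Hg) as HM.
  apply generated_field_derivation_closed.
  { intros f [Hf| ->]; [now apply (sf_mero _ _ _ HsK)|exact Hg]. }
  assert (Hincl : forall f, K f -> adjoin lo hi K g f)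
    by (intros f Hf; apply generated_field_incl; now left).
  assert (HMg : adjoin lo hi K g g) by (apply generated_field_incl; now right).
  intros f [Hf| ->]; [now apply Hincl, IH|].
  destruct Hstep as [[s [Hs E]]|[[s [Hs [Hne E]]]|Halg]].
  - apply (sf_compat _ _ _ HM (fun x => CDerive s x * g x)).
    + apply (sf_mul _ _ _ HM); [now apply Hincl, IH|exact HMg].
    + revert E; apply generically_imp; auto.
  - apply (sf_compat _ _ _ HM (fun x => CDerive s x * / s x)).
    + apply (sf_mul _ _ _ HM); [now apply Hincl, IH|].
      apply (sf_inv _ _ _ HM); auto.
    + revert E; apply generically_imp; auto.
  - now apply algebraic_CDerive.
Qed.

(** Induction on the second tower: its generators are adjoined to a field that
    already contains the first. *)
Lemma elementary_field_compositum (K1 K2 : (R -> C) -> Prop) :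
  elementary_field lo hi K1 -> elementary_field lo hi K2 ->
  exists K3, elementary_field lo hi K3 /\
    (forall f, K1 f -> K3 f) /\ (forall f, K2 f -> K3 f).
Proof.
  intros H1; induction 1 as [|K2 g H2 IH Hg Hstep].
  - exists K1; repeat split; auto.
    intros f Hf; apply Hf; [now apply elementary_field_subfield|].
    intros h [[c ->] | ->]; [now apply elementary_field_const|].
    clear Hf; induction H1; apply generated_field_incl; auto.
  - destruct IH as (K3 & H3 & I1 & I2).
    pose proof (elementary_field_subfield K3 H3) as HsK.
    exists (adjoin lo hi K3 g); split; [|split].
    + apply elementary_field_step; [exact H3|exact Hg|].
      destruct Hstep as [[s [Hs E]]|[[s [Hs [Hne E]]]|Halg]].
      * left; exists s; auto.
      * right; left; exists s; auto.
      * right; right.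
        destruct (algebraic_over_annihilated K2 K3 g I2 Halg) as [m Hm].
        destruct (minimal_annihilator K3 g m Hm) as (P & n & HP & Hroot & Hmin).
        exists P, n; split; [|exact Hroot].
        now apply minimal_poly_irreducible with g.
    + intros f Hf; apply generated_field_incl; auto.
    + intros f Hf; apply Hf; [now apply adjoin_subfield|].
      intros h [Hh| ->]; apply generated_field_incl; auto.
Qed.

End Fields.

(** * Smooth functions and integration by parts *)

Section Smooth.

Context (lo hi : Rbar).

Lemma smooth_on_is_Cderive (f : R -> C) (x : R) :
  smooth_on lo hi f -> in_itv lo hi x -> is_Cderive f x (CDerive f x).
Proof. intros Hf Hx; destruct (Hf 1%nat x Hx); now apply is_Cderive_correct. Qed.

(** A class of functions that is closed under differentiation consists of smooth
    functions.  This replaces Leibniz formulas for higher derivatives. *)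
Lemma smooth_on_coinduction (P : (R -> C) -> Prop) :
  (forall f, P f -> exists F, P F /\
     forall x, in_itv lo hi x -> is_Cderive f x (F x)) ->
  forall f, P f -> smooth_on lo hi f.
Proof.
  intros HP f Hf.
  assert (Hn : forall n, exists F, P F /\
    forall x, in_itv lo hi x -> CDerive_n n f x = F x).
  { induction n as [|n [F [HF E]]].
    - exists f; split; [exact Hf|]; intros x _; symmetry; apply surjective_pairing.
    - destruct (HP F HF) as [F' [HF' HD]]; exists F'; split; [exact HF'|].
      intros x Hx; rewrite <- (is_Cderive_unique _ _ _ (HD x Hx)).
      change (CDerive (CDerive_n n f) x = CDerive F x); apply CDerive_ext_loc.
      generalize (locally_in_itv x Hx); apply filter_imp; exact E. }
  intros [|n] x Hx; [now split|].
  destruct (Hn n) as [F [HF E]], (HP F HF) as [F' [_ HD]].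
  assert (Hloc : locally x (fun y => F y = CDerive_n n f y)).
  { generalize (locally_in_itv x Hx); apply filter_imp.
    intros y Hy; symmetry; now apply E. }
  destruct (is_Cderive_ext_loc _ _ _ _ Hloc (HD x Hx)) as [HRe HIm].
  split; eexists; [exact HRe|exact HIm].
Qed.

Lemma ex_derive_n_Derive (f : R -> R) (n : nat) (x : R) :
  ex_derive_n f (S n) x -> ex_derive_n (Derive f) n x.
Proof.
  destruct n as [|n]; [easy|].
  apply ex_derive_ext; intros y.
  rewrite (Derive_n_comp f n 1); now rewrite Nat.add_1_r.
Qed.

Lemma smooth_on_CDerive (f : R -> C) :
  smooth_on lo hi f -> smooth_on lo hi (CDerive f).
Proof.
  intros Hf n x Hx; destruct (Hf (S n) x Hx).
  now split; apply ex_derive_n_Derive.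
Qed.

Lemma smooth_on_primitive (f F : R -> C) :
  smooth_on lo hi F -> (forall x, in_itv lo hi x -> is_Cderive f x (F x)) ->
  smooth_on lo hi f.
Proof.
  intros HF Hf; apply (smooth_on_coinduction (fun h => h = f \/ smooth_on lo hi h));
    [|now left].
  intros h [-> | Hh].
  - exists F; auto.
  - exists (CDerive h); split; [right; now apply smooth_on_CDerive|].
    intros x Hx; now apply smooth_on_is_Cderive.
Qed.

Lemma smooth_on_CDerive_n (f : R -> C) (n : nat) :
  smooth_on lo hi f -> smooth_on lo hi (CDerive_n n f).
Proof.
  intros Hf; induction n as [|n IH]; [exact Hf|].
  exact (smooth_on_CDerive _ IH).
Qed.

(** The derivative of a product is a sum of products, so the products alone are not
    closed under differentiation, but this class is. *)
Inductive smooth_generated : (R -> C) -> Prop :=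
| smooth_generated_base f : smooth_on lo hi f -> smooth_generated f
| smooth_generated_plus f h :
    smooth_generated f -> smooth_generated h ->
    smooth_generated (fun x => f x + h x)
| smooth_generated_mult f h :
    smooth_generated f -> smooth_generated h ->
    smooth_generated (fun x => f x * h x).

Lemma smooth_on_mult (f h : R -> C) :
  smooth_on lo hi f -> smooth_on lo hi h -> smooth_on lo hi (fun x => f x * h x).
Proof.
  intros Hf Hh; apply (smooth_on_coinduction smooth_generated);
    [|now apply smooth_generated_mult; apply smooth_generated_base].
  clear; induction 1 as [f Hf|f h Hf [F [HF IHf]] Hh [H [HH IHh]]
                        |f h Hf [F [HF IHf]] Hh [H [HH IHh]]].
  - exists (CDerive f); split.
    + now apply smooth_generated_base, smooth_on_CDerive.
    + intros x Hx; now apply smooth_on_is_Cderive.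
  - exists (fun x => F x + H x); split.
    + now apply smooth_generated_plus.
    + intros x Hx; apply is_Cderive_plus; auto.
  - exists (fun x => F x * h x + f x * H x); split.
    + now apply smooth_generated_plus; apply smooth_generated_mult.
    + intros x Hx; apply is_Cderive_mult; auto.
Qed.

Lemma CDerive_n_CDerive (f : R -> C) (n : nat) (x : R) :
  CDerive_n n (CDerive f) x = CDerive_n (S n) f x.
Proof.
  rewrite <- (Nat.add_1_r n); apply injective_projections.
  - exact (Derive_n_comp (fun y => Re (f y)) n 1 x).
  - exact (Derive_n_comp (fun y => Im (f y)) n 1 x).
Qed.

(** One step: [a nu^(n+1)] is the derivative of [a nu^(n)] minus [a' nu^(n)], and
    the induction hypothesis for [a'] gives a primitive of the latter.  At [n = 0]
    what is left to integrate is the derivative of [S]. *)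
Lemma integration_by_parts
    (K : (R -> C) -> Prop) (nu S : R -> C) (n : nat) (a : R -> C) :
  subfield lo hi K -> derivation_closed K ->
  smooth_on lo hi nu -> smooth_on lo hi a -> K nu -> K a -> K S ->
  (forall x, in_itv lo hi x -> is_Cderive S x (CDerive_n n a x * nu x)) ->
  exists U, K U /\
    forall x, in_itv lo hi x -> is_Cderive U x (a x * CDerive_n n nu x).
Proof.
  intros HK HD Hnu Ha Knu Ka KS; revert a Ha Ka.
  assert (Kn : forall m, K (CDerive_n m nu)).
  { induction m as [|m IH]; [|exact (HD _ IH)].
    apply (sf_ext lo hi K HK nu); [exact Knu|].
    intros x; apply surjective_pairing. }
  induction n as [|n IH]; intros a Ha Ka HS.
  - exists S; split; [exact KS|]; intros x Hx.
    apply is_Cderive_eq with (1 := HS x Hx); unfold CDerive_n; simpl.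
    now rewrite <- !surjective_pairing.
  - destruct (IH (CDerive a)) as [V [KV HV]].
    + now apply smooth_on_CDerive.
    + now apply HD.
    + intros x Hx; rewrite CDerive_n_CDerive; now apply HS.
    + exists (fun x => a x * CDerive_n n nu x + - V x); split.
      * apply (sf_add _ _ _ HK); [|now apply (sf_opp _ _ _ HK)].
        now apply (sf_mul _ _ _ HK).
      * intros x Hx; eapply is_Cderive_eq.
        -- apply is_Cderive_plus; [apply is_Cderive_mult|apply is_Cderive_opp].
           ++ now apply smooth_on_is_Cderive.
           ++ apply smooth_on_is_Cderive; [now apply smooth_on_CDerive_n|exact Hx].
           ++ now apply HV.
        -- change (CDerive (CDerive_n n nu) x) with (CDerive_n (Datatypes.S n) nu x).
           ring.
Qed.

(** The fundamental theorem of calculus, for real and imaginary parts. *)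
Lemma RInt_Cderive (F f : R -> C) (a b : R) :
  in_itv lo hi a -> in_itv lo hi b ->
  (forall x, in_itv lo hi x -> is_Cderive F x (f x)) -> smooth_on lo hi f ->
  @RInt C_R_CompleteNormedModule f a b = F b - F a.
Proof.
  intros Ha Hb HF Hf; apply is_RInt_unique.
  assert (Hin : forall x, (Rmin a b <= x <= Rmax a b)%R -> in_itv lo hi x)
    by (intros x; now apply itv_between).
  apply (is_RInt_fct_extend_pair (U := R_NormedModule) (V := R_NormedModule) f).
  - apply (is_RInt_derive (fun x => Re (F x)) (fun x => Re (f x))).
    + intros x Hx; apply (HF x (Hin x Hx)).
    + intros x Hx; apply (ex_derive_continuous (fun y => Re (f y)) x).
      apply (Hf 1%nat x (Hin x Hx)).
  - apply (is_RInt_derive (fun x => Im (F x)) (fun x => Im (f x))).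
    + intros x Hx; apply (HF x (Hin x Hx)).
    + intros x Hx; apply (ex_derive_continuous (fun y => Im (f y)) x).
      apply (Hf 1%nat x (Hin x Hx)).
Qed.

Lemma factored_op_step (f : nat -> R -> C) (m : nat) (u v w : R -> C) :
  (forall x, in_itv lo hi x -> factored_op f m u x = CDerive v x) ->
  (forall x, in_itv lo hi x -> f (S m) x * CDerive v x = w x) ->
  forall x, in_itv lo hi x -> factored_op f (S m) u x = CDerive w x.
Proof.
  intros Hv Hw x Hx; simpl; apply CDerive_ext_loc.
  generalize (locally_in_itv x Hx); apply filter_imp; intros y Hy.
  rewrite Hv by exact Hy; now apply Hw.
Qed.

End Smooth.

Theorem proposition5p11 (lo hi : Rbar) (x0 : R) (hx0 : in_itv lo hi x0)
    (k : nat) (hk : (4 <= k)%nat)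
    (f : nat -> R -> C)
    (f_smooth : forall i, (1 <= i <= k - 1)%nat -> smooth_on lo hi (f i))
    (f_neq0 : forall i, (1 <= i <= k - 1)%nat ->
       forall x, in_itv lo hi x -> f i x <> 0)
    (T : Type) (g : R -> T -> C)
    (gi : nat -> R -> T -> C) (Rf G : R -> T -> C)
    (g_smooth : forall t, smooth_on lo hi (fun x => g x t))
    (G_smooth : forall t, smooth_on lo hi (fun x => G x t))
    (Rf_smooth : forall t, smooth_on lo hi (fun x => Rf x t))
    (gi_smooth : forall i, (2 <= i <= k - 2)%nat ->
       forall t, smooth_on lo hi (fun x => gi i x t))
    (gi2_elementary : elementary_wrt_x lo hi T (gi 2%nat))
    (G_eq : forall t x, in_itv lo hi x ->
       CDerive (fun y => G y t) x = g x t)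
    (Rf_eq : forall t x, in_itv lo hi x ->
       f (k - 1)%nat x * CDerive (fun y => Rf y t) x = G x t)
    (gi_last_eq : forall t x, in_itv lo hi x ->
       f (k - 2)%nat x * CDerive (fun y => gi (k - 2)%nat y t) x = Rf x t)
    (gi_eq : forall i, (2 <= i <= k - 3)%nat -> forall t x, in_itv lo hi x ->
       f i x * CDerive (fun y => gi i y t) x = gi (i + 1)%nat x t)
    (nu_S : forall t, exists (nu S : R -> C) (p : nat),
       (0 < p)%nat /\
       smooth_on lo hi nu /\ elementary lo hi nu /\
       smooth_on lo hi S /\ elementary lo hi S /\
       (forall x, in_itv lo hi x -> CDerive_n (p + 1) nu x = 1 / f 1%nat x) /\
       (forall x, in_itv lo hi x ->
          CDerive S x = CDerive_n (p + 1) (fun y => gi 2%nat y t) x * nu x)) :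
  let u := fun (x : R) (t : T) =>
    @RInt C_R_CompleteNormedModule (fun s => gi 2%nat s t / f 1%nat s) x0 x in
  elementary_wrt_x lo hi T u /\
  forall t, is_solution lo hi f (k - 1) (fun x => g x t) (fun x => u x t).
Proof.
  intros u.
  (* [W] is the primitive, built by parts, of [F = g_2 nu^(p+1)] that vanishes at
     [x0]; it agrees with [u] on the interval and lies in the field [K]. *)
  assert (Hu : forall t, exists (K : (R -> C) -> Prop) (W F : R -> C),
    elementary_field lo hi K /\ K W /\ smooth_on lo hi F /\
    (forall x, in_itv lo hi x -> u x t = W x) /\
    (forall x, in_itv lo hi x -> is_Cderive W x (F x)) /\
    (forall x, in_itv lo hi x -> F x = gi 2%nat x t / f 1%nat x)).
  { intros t; destruct (nu_S t) as (nu & S & p & _ & nu_smooth & [K2 [HK2 nu_K2]] &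
      S_smooth & [K3 [HK3 S_K3]] & nu_eq & S_eq).
    destruct (gi2_elementary t) as [K1 [HK1 g2_K1]].
    destruct (elementary_field_compositum lo hi x0 hx0 K1 K2 HK1 HK2)
      as (K12 & HK12 & I1 & I2).
    destruct (elementary_field_compositum lo hi x0 hx0 K12 K3 HK12 HK3)
      as (K & HK & I12 & I3).
    pose proof (elementary_field_subfield lo hi x0 hx0 K HK) as HsK.
    assert (g2_smooth : smooth_on lo hi (fun x => gi 2%nat x t))
      by (apply gi_smooth; lia).
    destruct (integration_by_parts lo hi K nu S (p + 1) (fun x => gi 2%nat x t))
      as [U [KU HU]]; auto.
    { now apply (elementary_field_derivation_closed lo hi x0 hx0). }
    { intros x Hx; rewrite <- S_eq by exact Hx.
      now apply (smooth_on_is_Cderive lo hi). }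
    set (F := fun x => gi 2%nat x t * CDerive_n (p + 1) nu x) in HU.
    assert (F_eq : forall x, in_itv lo hi x -> F x = gi 2%nat x t / f 1%nat x).
    { intros x Hx; unfold F; rewrite nu_eq by exact Hx.
      field; apply f_neq0; [lia|exact Hx]. }
    assert (F_smooth : smooth_on lo hi F)
      by now apply smooth_on_mult; [|apply smooth_on_CDerive_n].
    exists K, (fun x => U x + - U x0), F.
    split; [exact HK|split; [|split; [exact F_smooth|split; [|split; [|exact F_eq]]]]].
    - apply (sf_add _ _ _ HsK); [exact KU|].
      now apply (elementary_field_const lo hi).
    - intros x Hx; unfold u.
      rewrite <- (RInt_ext (V := C_R_CompleteNormedModule) F).
      + now apply (RInt_Cderive lo hi).
      + intros y Hy; apply F_eq, (itv_between lo hi x0 x); auto; lra.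
    - intros x Hx; apply is_Cderive_eq with (F x + 0); [|ring].
      apply is_Cderive_plus; [now apply HU|apply is_Cderive_const]. }
  split.
  - intros t; destruct (Hu t) as (K & W & F & HK & KW & _ & E & _).
    exists K; split; [exact HK|].
    pose proof (elementary_field_subfield lo hi x0 hx0 K HK) as HsK.
    apply (sf_compat _ _ _ HsK W); [exact KW|].
    apply generically_on; intros x Hx; symmetry; now apply E.
  - intros t; destruct (Hu t) as (K & W & F & _ & _ & F_smooth & E & HW & F_eq).
    assert (Hdu : forall x, in_itv lo hi x -> is_Cderive (fun y => u y t) x (F x)).
    { intros x Hx; apply (is_Cderive_ext_loc W); [|now apply HW].
      generalize (locally_in_itv x Hx); apply filter_imp.
      intros y Hy; symmetry; now apply E. }
    split; [now apply (smooth_on_primitive lo hi _ F)|].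
    (* After [m + 2] differentiations the hypotheses on [f_1], ..., [f_(m+1)] have
       turned the left-hand side into the derivative of [g_(m+2)]. *)
    assert (Hop : forall m, (m + 2 <= k - 2)%nat -> forall x, in_itv lo hi x ->
      factored_op f (S m) (fun y => u y t) x = CDerive (fun y => gi (m + 2)%nat y t) x).
    { induction m as [|m IH]; intros Hm.
      - apply factored_op_step with (fun y => u y t); [easy|].
        intros x Hx; rewrite (is_Cderive_unique _ _ _ (Hdu x Hx)), F_eq by exact Hx.
        simpl; field; apply f_neq0; [lia|exact Hx].
      - apply factored_op_step with (fun y => gi (m + 2)%nat y t); [apply IH; lia|].
        intros x Hx; replace (S m + 2)%nat with (m + 2 + 1)%nat by lia.
        replace (S (S m)) with (m + 2)%nat by lia.
        apply gi_eq; [lia|exact Hx]. }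
    assert (HRf : forall x, in_itv lo hi x ->
      factored_op f (k - 2) (fun y => u y t) x = CDerive (fun y => Rf y t) x).
    { replace (k - 2)%nat with (S (S (k - 4))) by lia.
      apply factored_op_step with (fun y => gi (k - 2)%nat y t).
      - replace (k - 2)%nat with (k - 4 + 2)%nat by lia; apply Hop; lia.
      - replace (S (S (k - 4))) with (k - 2)%nat by lia; apply gi_last_eq. }
    intros x Hx; rewrite <- G_eq by exact Hx; revert x Hx.
    replace (k - 1)%nat with (S (k - 2)) by lia.
    apply factored_op_step with (fun y => Rf y t); [exact HRf|].
    replace (S (k - 2)) with (k - 1)%nat by lia; apply Rf_eq.
Qed.
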